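(* Let $m,n$ be positive integers with $m\le n$. Let $Y\in\mathcal{F}(Y_{m,n})$, and let $\lambda=(\lambda_1,\ldots,\lambda_m)$ be the partition corresponding to $Y$, i.e. $Y=Y_\lambda$. The following four conditions are equivalent: (I) $Y\in\mathcal{S}(Y_{m,n})$; (II) $Y^{D}\in\mathcal{S}(Y_{m,n})$; (III) $I_R(Y)\cap I_R(Y^{D})=\emptyset$; (IV) $\lambda_i+\lambda_j\neq n-m+i+j-1$ for all $1\le i\le j\le m$.
   Context: Fix positive integers $m\le n$; $[a,b]$ denotes $\{x\in\mathbb{Z}\mid a\le x\le b\}$. Young diagrams. To a sequence of integers $\lambda=(\lambda_1,\ldots,\lambda_m)$ with $n\ge\lambda_1\ge\cdots\ge\lambda_m\ge 0$ one associates the Young diagram $Y_\lambda=\{(i,j)\in\mathbb{N}^2\mid 1\le i\le m,\ 1\le j\le\lambda_i\}$ ($\mathbb{N}$ = positive integers). $\mathcal{F}(Y_{m,n})$ is the set of all such $Y_\lambda$, i.e. of all Young diagrams contained in the rectangle $Y_{m,n}=\{(i,j)\mid 1\le i\le m,\ 1\le j\le n\}$; $\emptyset$ is the empty Young diagram. The dual diagram is $Y_\lambda^{D}=Y_{\lambda^{D}}$ with $\lambda^{D}=(n-\lambda_m,\ldots,n-\lambda_1)$. Put $I(Y_\lambda)=\{\lambda_{m-t+1}+t\mid 1\le t\le m\}$, an $m$-element subset of $[1,m+n]$. Put $\chi=1$ if $m+n$ is even and $\chi=0$ if $m+n$ is odd, $c=(m+n-1+\chi)/2$, and $I_R(Y)=I(Y)\cap[c+1-\chi,\,m+n]$.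 Hooks. For $(i,j)\in Y$, the hook at $(i,j)$ is $H_Y(i,j)=\{(i,j)\}\cup\{(i,j')\in Y\mid j'>j\}\cup\{(i',j)\in Y\mid i'>i\}$. Removing it gives the Young diagram $Y\langle i,j\rangle=\{(i',j')\in Y\mid i'<i\text{ or }j'<j\}\cup\{(i'-1,j'-1)\mid (i',j')\in Y,\ i'>i\text{ and }j'>j\}$. Unimodal numbering. The box $(i,j)$ carries the number $c(i,j)=\min(j-i+m,\ i-j+n)$. For $(i,j)\in Y$, $\mathcal{H}_Y(i,j)$ denotes the multiset of the numbers $c(a,b)$ for $(a,b)\in H_Y(i,j)$. Multiple Hook Removing Game (MHRG) with starting position $Y_{m,n}$. Positions are diagrams in $\mathcal{F}(Y_{m,n})$; the starting position is $Y_{m,n}$. From a position $Y\ne\emptyset$ the player chooses a box $(i,j)\in Y$ and forms $Y\langle i,j\rangle$. It is known that there is at most one box $(i',j')\in Y\langle i,j\rangle$ with $\mathcal{H}_{Y\langle i,j\rangle}(i',j')=\mathcal{H}_Y(i,j)$ as multisets. If there is none, the player moves from $Y$ to $Y\langle i,j\rangle$; if there is one, the player moves from $Y$ to $(Y\langle i,j\rangle)\langle i',j'\rangle$. The unique ending position is $\emptyset$. $\mathcal{S}(Y_{m,n})$ is the set of all diagrams in $\mathcal{F}(Y_{m,n})$ that appear as positions of this game, i.e. that can be reached from $Y_{m,n}$ by a (possibly empty) finite sequence of moves. *)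

(* Defs.v *)
From mathcomp Require Import all_boot finmap.

Set Implicit Arguments.
Unset Strict Implicit.
Unset Printing Implicit Defensive.

Local Open Scope fset_scope.
Local Open Scope nat_scope.

(* Boxes (i, j) and the parts of a partition are indexed from 1. *)
Definition part m (lam : m.-tuple nat) (i : nat) : nat := nth 0 lam i.-1.

(* [path geq n lam] unfolds to n >= lam_1 >= ... >= lam_m. *)
Definition boxed_partition m (n : nat) (lam : m.-tuple nat) : bool :=
  path geq n lam.

Definition diagram := {fset nat * nat}.

Definition young m (lam : m.-tuple nat) : diagram :=
  [fset ((i, j) : nat * nat) | i in iota 1 m, j in iota 1 (part lam i)].

Definition rectangle (m n : nat) : diagram :=
  [fset ((i, j) : nat * nat) | i in iota 1 m, j in iota 1 n].

(* The family F(Y_{m,n}). *)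
Definition boxed_diagram (m n : nat) (Y : diagram) : Prop :=
  exists2 lam : m.-tuple nat, boxed_partition n lam & Y = young lam.

Definition dual m (n : nat) (lam : m.-tuple nat) : m.-tuple nat :=
  [tuple of rev [tuple of map (fun x => n - x) lam]].

Definition I_set m (lam : m.-tuple nat) : {fset nat} :=
  [fset part lam (m - t + 1) + t | t in iota 1 m].

Definition chi (m n : nat) : nat := if odd (m + n) then 0 else 1.

Definition cmid (m n : nat) : nat := (m + n - 1 + chi m n) %/ 2.

Definition I_R m (n : nat) (lam : m.-tuple nat) : {fset nat} :=
  [fset k in I_set lam | cmid m n + 1 - chi m n <= k <= m + n].

Definition hook (Y : diagram) (b : nat * nat) : diagram :=
  b |` [fset p in Y | ((p.1 == b.1) && (b.2 < p.2))
                      || ((p.2 == b.2) && (b.1 < p.1))].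

Definition remove_hook (Y : diagram) (b : nat * nat) : diagram :=
  [fset p in Y | (p.1 < b.1) || (p.2 < b.2)]
  `|` [fset ((p.1.-1, p.2.-1) : nat * nat)
          | p in Y & (b.1 < p.1) && (b.2 < p.2)].

(* min(j - i + m, i - j + n); the truncated subtractions are exact on the
   boxes of [rectangle m n]. *)
Definition box_number (m n : nat) (p : nat * nat) : nat :=
  minn (p.2 + m - p.1) (p.1 + n - p.2).

(* Multisets are represented by sequences compared with [perm_eq]. *)
Definition hook_numbers (m n : nat) (Y : diagram) (b : nat * nat) : seq nat :=
  [seq box_number m n p | p <- hook Y b].

Definition same_hook_numbers (m n : nat) (Y : diagram) (b : nat * nat)
    (Y' : diagram) (b' : nat * nat) : bool :=
  perm_eq (hook_numbers m n Y' b') (hook_numbers m n Y b).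

Definition mhrg_move (m n : nat) (Y Z : diagram) : Prop :=
  exists2 b, b \in Y &
    let Y1 := remove_hook Y b in
    ((forall b', b' \in Y1 -> ~~ same_hook_numbers m n Y b Y1 b') /\ Z = Y1)
    \/ (exists b', [/\ b' \in Y1, same_hook_numbers m n Y b Y1 b'
                     & Z = remove_hook Y1 b']).

Inductive reachable (m n : nat) : diagram -> Prop :=
| reachable_start : reachable m n (rectangle m n)
| reachable_move Y Z : reachable m n Y -> mhrg_move m n Y Z -> reachable m n Z.

(* The set S(Y_{m,n}) of positions of the game. *)
Definition mhrg_position (m n : nat) (Y : diagram) : Prop :=
  boxed_diagram m n Y /\ reachable m n Y.

(* Main.v *)
Require Import Defs.
From mathcomp Require Import all_boot finmap zify.

Local Open Scope fset_scope.
Local Open Scope nat_scope.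

(** The theorem becomes transparent once a diagram is replaced by the set I(Y)
of its beads in [1, m + n]. Removing the hook at a box replaces a bead x by a
vacant position y < x, and every such pair (x, y) comes from exactly one box.
The contents of the hook, shifted by m, are y, ..., x - 1, so its multiset of
numbers is that of min(d, m + n - d) over this interval. That multiset
determines the interval up to the mirror symmetry z |-> m + n + 1 - z of the
bead positions ([perm_rim_numbers]). The interval itself cannot occur again,
since x has just been vacated; so a move of the game sends x to y and then, if
the mirror of y is occupied and the mirror of x is vacant, also sends the
mirror of y to the mirror of x ([mhrg_moveP]).

Dualising a diagram mirrors its beads, hence (III) says that no bead is the
mirror image of a bead, itself included: the bead set is asymmetric. (IV) is
the same condition written with the beads lam_i + m + 1 - i, and asymmetry is
plainly invariant under mirroring, which gives (I) <-> (II).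

Moves preserve asymmetry: if x goes to y while the mirror of y is occupied, the
mirror of x is vacant because x was a bead, so the compensating second jump
takes place ([mhrg_result_asymmetric]). The bead set {n + 1, ..., n + m} of the
rectangle is asymmetric because m <= n. Conversely, an asymmetric bead set
other than that one has an asymmetric predecessor, from which a single jump
leads to it: raise a bead of the left half to its mirror image, or, if there is
none, raise a bead that is at most n to a vacant position beyond n. A counting
measure decreases, so that going back in this way ends at the rectangle
([asymmetric_reachable]).

The passage between diagrams and bead sets uses only the number [above] of
beads at or beyond a position. If Y is the diagram of I, then (a, b) is in Y
exactly when at least a beads lie at or beyond b + m + 1 - a. *)

(** * Counting beads *)

Definition above (m n : nat) (I : pred nat) (t : nat) : nat :=
  count I (iota t ((m + n).+1 - t)).

Definition swap (I : pred nat) (x y : nat) : pred nat :=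
  fun z => (z == y) || (I z && (z != x)).

(** Row a contains a box in column b exactly when the a-th largest bead is at
least b + m + 1 - a; the condition on [above] says so without sorting the
beads. *)
Definition diagram_of (m n : nat) (I : pred nat) : diagram :=
  [fset p in rectangle m n | p.1 <= above m n I (p.2 + m.+1 - p.1)].

Definition jump (m n : nat) (I : pred nat) (x y : nat) : Prop :=
  [/\ I x, ~~ I y, 0 < y < x & x <= m + n].

(** The hook at b belongs to the jump from x to y: x is the bead of the row of b,
that is the b.1-th largest one, and y is the vacant position of the column of
b, that is the b.2-th smallest one, vacant positions up to y being counted as
y - (m - above m n I y). *)
Definition rim_ends (m n : nat) (I : pred nat) (b : nat * nat) (x y : nat) :=
  above m n I x = b.1 /\ y + above m n I y = b.2 + m.

(** The box numbers along the boundary strip between y and x; the box of content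
d - m carries the number min(d, m + n - d). *)
Definition rim_numbers (m n y x : nat) : seq nat :=
  [seq minn d (m + n - d) | d <- iota y (x - y)].

Lemma aboveS m n I t : t <= m + n -> above m n I t = I t + above m n I t.+1.
Proof. by move=> le_t; rewrite /above (subSn le_t) /= subSS. Qed.

Lemma above_out m n I t : m + n < t -> above m n I t = 0.
Proof. by rewrite /above -subn_eq0 => /eqP ->. Qed.

Lemma above_bounds m n I s t : s <= t ->
  above m n I t <= above m n I s <= above m n I t + (t - s).
Proof.
move=> le_st; rewrite -(subnKC le_st) addKn; elim: (t - s) => [|d IHd].
  by rewrite !addn0 leqnn.
have [out|le_d] := ltnP (m + n) (s + d).
  by move: IHd; rewrite !(above_out m n I (s + _)) //; lia.
by move: IHd; rewrite (aboveS m n I (s + d)) // addnS; case: (I _); lia.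
Qed.

Lemma eq_above m n I J : {in [pred t | 0 < t <= m + n], I =1 J} ->
  forall t, 0 < t -> above m n I t = above m n J t.
Proof.
move=> eqIJ t t_gt0; apply: eq_in_count => z; rewrite mem_iota => zP.
by apply: eqIJ; rewrite inE; lia.
Qed.

(** Moving a bead from x down to y affects only the counts at the positions that
it jumps over. *)
Lemma above_swap m n I x y t : jump m n I x y ->
  above m n I t = above m n (swap I x y) t + (y < t <= x).
Proof.
case=> Ix Iy /andP[y_gt0 lt_yx] le_x.
elim: {t}((m + n).+1 - t) {-2}t (erefl ((m + n).+1 - t)) => [|d IHd] t def_d.
  by rewrite !above_out; lia.
have le_t : t <= m + n by lia.
rewrite !(aboveS m n _ t) // (IHd t.+1); last by lia.
rewrite /swap; have [->|ne_y] := eqVneq t y; first by rewrite (negPf Iy); lia.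
have [->|ne_x] := eqVneq t x; first by rewrite Ix; lia.
by rewrite andbT orFb; lia.
Qed.

Lemma above_lt_exists m n I s t : s <= t -> above m n I t < above m n I s ->
  exists2 w, s <= w < t & I w.
Proof.
move=> le_st; rewrite -(subnKC le_st); elim: (t - s) => [|d IHd].
  by rewrite addn0 ltnn.
have := above_bounds m n I (s + d) (s + d).+1 (leqnSn _).
have [I_d _ _|I'd bnd lt_d] := boolP (I (s + d)).
  by exists (s + d) => //; lia.
case: IHd => [|w wP Iw]; last by exists w => //; lia.
have [le_d|out] := leqP (s + d) (m + n); last first.
  by have := above_out m n I (s + d) out; rewrite addnS in lt_d; lia.
by rewrite (aboveS m n I (s + d)) // (negPf I'd); rewrite addnS in lt_d; lia.
Qed.

(** * Diagrams of bead sets *)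

Lemma mem_rectangle m n p : (p \in rectangle m n) =
  (0 < p.1 <= m) && (0 < p.2 <= n).
Proof.
apply/imfset2P/idP => [[i + [j + ->]]|] /=.
  by rewrite !mem_iota; lia.
by case: p => i j /= ijP; exists i; rewrite ?mem_iota; [lia|];
  exists j; rewrite ?mem_iota; [lia|].
Qed.

(** As there are m beads in [1, m + n], the counting condition forces a <= m and
b <= n. *)
Lemma mem_diagram_of m n I p : above m n I 1 = m ->
  (p \in diagram_of m n I) =
  [&& 0 < p.1, 0 < p.2 & p.1 <= above m n I (p.2 + m.+1 - p.1)].
Proof.
move=> cardI; rewrite !inE mem_rectangle /=.
case: p => a b /=; have [out|le_t] := ltnP (m + n) (b + m.+1 - a).
  by rewrite above_out; lia.
have [pos|] := ltnP 0 (b + m.+1 - a); last first.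
  move=> le0; have ->: b + m.+1 - a = 0 by lia.
  rewrite (aboveS m n I 0) //.
  by have := above_bounds m n I 0 1 isT; lia.
have := above_bounds m n I 1 _ pos.
have := above_bounds m n I (b + m.+1 - a) (m + n).+1 (leqW le_t).
by rewrite (above_out m n I (m + n).+1) //; lia.
Qed.

(** * Hooks are jumps of a bead to a lower vacant position *)

Lemma jump_above m n I x y : jump m n I x y ->
  [/\ above m n I x = (above m n I x.+1).+1,
      above m n I y = above m n I y.+1
    & above m n I x.+1 < above m n I y].
Proof.
case=> Ix Iy /andP[y_gt0 lt_yx] le_x.
have := above_bounds m n I y x (ltnW lt_yx).
by rewrite (aboveS m n I x) // (aboveS m n I y) ?Ix ?(negPf Iy); [split|]; lia.
Qed.

(** At or beyond t there are as many beads as at or beyond x exactly when t <= x,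
as x is a bead; likewise t + above t, which counts vacant positions below t up
to a constant, exceeds its value at y exactly when y < t, as y is vacant. *)
Lemma jump_thresholds m n I x y t : jump m n I x y ->
  (above m n I x <= above m n I t) = (t <= x) /\
  (y + above m n I y < t + above m n I t) = (y < t).
Proof.
move=> xyP; have [eq_x eq_y _] := jump_above _ _ _ _ _ xyP; split.
  have [le_tx|lt_xt] := leqP t x; first by have := above_bounds m n I t x le_tx; lia.
  by have := above_bounds m n I x.+1 t lt_xt; lia.
have [le_ty|lt_yt] := leqP t y; first by have := above_bounds m n I t y le_ty; lia.
by have := above_bounds m n I y.+1 t lt_yt; lia.
Qed.

Lemma above_swap1 m n I x y : above m n I 1 = m -> jump m n I x y ->
  above m n (swap I x y) 1 = m.
Proof.
by move=> cardI xyP; have := above_swap m n I x y 1 xyP; case: xyP; lia.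
Qed.

Lemma jump_of_box m n I b : above m n I 1 = m -> b \in diagram_of m n I ->
  exists x y, jump m n I x y /\ rim_ends m n I b x y.
Proof.
case: b => i j cardI; rewrite mem_diagram_of //= => /and3P[i_gt0 j_gt0 le_i].
have le_im : i <= m.
  have : above m n I (j + m.+1 - i) <= above m n I 0.
    by have /andP[] := above_bounds m n I 0 _ (leq0n (j + m.+1 - i)).
  have := above_bounds m n I 1 (j + m.+1 - i); rewrite cardI.
  case: (ltnP 0 (j + m.+1 - i)) => [lt0 /(_ isT)|]; first by lia.
  move=> le0 _; have e0: j + m.+1 - i = 0 by lia.
  by move: le_i; rewrite e0 (aboveS m n I 0) // cardI; lia.
set t := j + m.+1 - i in le_i.
(* x is the last position with at least i beads at or beyond it; y is the
   first position with at least j vacant positions up to it. *)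
have exX : exists x, i <= above m n I x by exists t.
have bX x : i <= above m n I x -> x <= m + n.
  by move=> le_ix; rewrite leqNgt; apply/negP => /(above_out _ _ I); lia.
have [x le_ix maxx] := ex_maxnP exX bX.
have exY : exists y, j + m < y.+1 + above m n I y.+1.
  by exists t.-1; rewrite prednK; lia.
have [y lt_jy miny] := ex_minnP exY.
have lt_yt : y < t.
  by have := miny t.-1; rewrite prednK; lia.
have le_tx : t <= x by apply: maxx.
have y_gt0 : 0 < y by rewrite lt0n; apply: contraL lt_jy => /eqP->; lia.
have := miny y.-1; rewrite prednK // => minY.
have le_x := bX _ le_ix.
have := maxx x.+1; have := aboveS m n I x le_x.
have := aboveS m n I y ltac:(lia).
case Ix: (I x); case Iy: (I y); try by lia.
by move=> *; exists x, y; rewrite /jump /rim_ends Ix Iy /=; split; split; lia.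
Qed.

Lemma box_of_jump m n I x y : above m n I 1 = m -> jump m n I x y ->
  exists2 b, b \in diagram_of m n I & rim_ends m n I b x y.
Proof.
move=> cardI xyP; have [eq_x eq_y lt_xy] := jump_above _ _ _ _ _ xyP.
case: xyP => Ix Iy /andP[y_gt0 lt_yx] le_x.
have bnd1 := above_bounds m n I 1 y y_gt0.
exists (above m n I x, y + above m n I y - m); last by rewrite /rim_ends /=; lia.
rewrite mem_diagram_of //=.
have := above_bounds m n I y.+1 (y + above m n I y - m + m.+1 - above m n I x).
by lia.
Qed.

(** The shift along the diagonal turns the test of (a + 1, b + 1) into the test of
the same position t with a strict inequality: more than a beads are then
needed instead of at least a. This matches the loss of one bead at the
positions y < t <= x. For t <= y or x < t, no box with a >= i and b >= j passes
either test, so that the shift changes nothing. *)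
Lemma remove_hook_diagram m n I b x y :
  above m n I 1 = m -> jump m n I x y -> rim_ends m n I b x y ->
  remove_hook (diagram_of m n I) b = diagram_of m n (swap I x y).
Proof.
case: b => i j cardI xyP [/= def_i def_j].
have card' := above_swap1 _ _ _ _ _ cardI xyP.
have swapE t := above_swap m n I x y t xyP.
have [eq_x eq_y lt_xy] := jump_above _ _ _ _ _ xyP.
case: (xyP) => Ix Iy /andP[y_gt0 lt_yx] le_x.
have bnd1 := above_bounds m n I 1 y y_gt0.
apply/fsetP => -[a b]; rewrite mem_diagram_of //=.
have shiftE : ((a, b) \in [fset ((p.1.-1, p.2.-1) : nat * nat)
    | p in diagram_of m n I & (i < p.1) && (j < p.2)]) =
    [&& 0 < a, 0 < b, i <= a, j <= b & a < above m n I (b + m.+1 - a)].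
  apply/imfsetP/idP => [[[a' b'] /=]|abP].
    rewrite !inE mem_rectangle /= => abP [-> ->].
    have -> : b'.-1 + m.+1 - a'.-1 = b' + m.+1 - a' by lia.
    by lia.
  exists (a.+1, b.+1) => //=; rewrite inE mem_diagram_of //=.
  have -> : b.+1 + m.+1 - a.+1 = b + m.+1 - a by lia.
  by lia.
rewrite /remove_hook in_fsetU shiftE.
have -> : ((a, b) \in [fset p in diagram_of m n I | (p.1 < i) || (p.2 < j)]) =
   [&& 0 < a, 0 < b, (a < i) || (b < j) & a <= above m n I (b + m.+1 - a)].
  by rewrite in_fset inE /= mem_diagram_of //=; lia.
have := swapE (b + m.+1 - a).
have := jump_thresholds _ _ _ _ _ (b + m.+1 - a) xyP; rewrite def_i def_j.
move: (above m n I (b + m.+1 - a)) (above m n _ _) => k k' {swapE shiftE}.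
by move: def_i def_j eq_x eq_y lt_xy => _ _ _ _ _ [thr_x thr_y] eq_k; lia.
Qed.

(** The box of the hook at b on the diagonal of content d - m: it lies on the leg
of the hook below the content of b, and on the arm from there on. *)
Definition hook_box (m : nat) (b : nat * nat) (d : nat) : nat * nat :=
  if d + b.1 < b.2 + m then (b.2 + m - d, b.2) else (b.1, d + b.1 - m).

Lemma hook_numbers_diagram m n I b x y :
  above m n I 1 = m -> jump m n I x y -> rim_ends m n I b x y ->
  perm_eq (hook_numbers m n (diagram_of m n I) b) (rim_numbers m n y x).
Proof.
case: b => i j cardI xyP [/= def_i def_j].
have [eq_x eq_y lt_xy] := jump_above _ _ _ _ _ xyP.
case: (xyP) => Ix Iy /andP[y_gt0 lt_yx] le_x.
have bnd1 := above_bounds m n I 1 y y_gt0.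
have bndx := above_bounds m n I 1 x ltac:(lia).
have bndN := above_bounds m n I x (m + n).+1 (leqW le_x).
have out := above_out m n I (m + n).+1 (leqnn _).
have -> : rim_numbers m n y x =
    [seq box_number m n p | p <- [seq hook_box m (i, j) d | d <- iota y (x - y)]].
  rewrite -map_comp; apply/eq_in_map => d; rewrite mem_iota => dP /=.
  by rewrite /box_number /hook_box /=; case: ifP => /=; lia.
apply/perm_map/uniq_perm; rewrite ?fset_uniq //.
  rewrite map_inj_in_uniq ?iota_uniq // => d d'; rewrite !mem_iota /hook_box /=.
  by case: ifP; case: ifP => ? ? ? ? []; lia.
move=> [a b]; rewrite in_fset1U in_fset inE /= mem_diagram_of //=.
have [] := jump_thresholds _ _ _ _ _ (b + m.+1 - a) xyP.
rewrite def_i def_j; move: (above m n I (b + m.+1 - a)) => k thr_x thr_y.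
have [i_gt0 le_i le_ij] : [/\ 0 < i, i <= m & y + i <= j + m] by split; lia.
have [_ thr_xy] := jump_thresholds _ _ _ _ _ x xyP.
have [j_gt0 lt_jm] : 0 < j /\ j + m < x + i by split; lia.
clear thr_xy eq_x eq_y lt_xy bnd1 bndx bndN out def_i def_j xyP.
rewrite xpair_eqE /=.
apply/idP/mapP => [abP|[d]].
  exists (b + m - a); first by rewrite mem_iota; lia.
  by rewrite /hook_box /=; case: ifP => ?; congr (_, _); lia.
by rewrite mem_iota /hook_box /=; case: ifP => ? ? [? ?]; lia.
Qed.

(** * The game on bead sets *)

Local Notation mirror m n z := ((m + n).+1 - z).

(** The function min(d, m + n - d) is concave, so its minimum over the interval is
reached at an end and equals min(y, mirror x). With the length x - y this
determines y + mirror x as well, hence the unordered pair {y, mirror x}. *)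
Lemma perm_rim_numbers m n x y x' y' : 0 < y < x -> x <= m + n ->
    0 < y' < x' -> x' <= m + n ->
  perm_eq (rim_numbers m n y' x') (rim_numbers m n y x) =
  ((y' == y) && (x' == x)) || ((y' == mirror m n x) && (x' == mirror m n y)).
Proof.
move=> lt_yx le_x lt_yx' le_x'.
have in_min u v : 0 < u < v -> v <= m + n ->
    minn u (mirror m n v) \in rim_numbers m n u v.
  move=> lt_uv le_v; apply/mapP; have [le_u|gt_u] := leqP u (mirror m n v).
    by exists u; rewrite ?mem_iota; lia.
  by exists v.-1; rewrite ?mem_iota; lia.
have ge_min u v d : v <= m + n -> d \in rim_numbers m n u v ->
    minn u (mirror m n v) <= d.
  by move=> le_v /mapP[e]; rewrite mem_iota => + ->; lia.
apply/idP/idP => [eq_num|/orP[]/andP[/eqP-> /eqP->]]; last 2 first.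
- exact: perm_refl.
- have refl_iota : perm_eq (iota (mirror m n x) (mirror m n y - mirror m n x))
                      [seq m + n - d | d <- iota y (x - y)].
    apply: uniq_perm; rewrite ?iota_uniq ?map_inj_in_uniq ?iota_uniq //.
      by move=> d e; rewrite !mem_iota; lia.
    move=> d; rewrite mem_iota; apply/idP/mapP => [dP|[e]].
      by exists (m + n - d); rewrite ?mem_iota; lia.
    by rewrite mem_iota => ? ->; lia.
  rewrite /rim_numbers; apply: (perm_trans (perm_map _ refl_iota)).
  set minus := fun d => m + n - d; set number := fun d => minn d (m + n - d).
  have /eq_in_map eq_number : {in iota y (x - y), number \o minus =1 number}.
    by move=> d; rewrite mem_iota /number /minus /=; lia.
  by rewrite -map_comp eq_number perm_refl.
have eq_size : x' - y' = x - y.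
  by have := perm_size eq_num; rewrite !size_map !size_iota.
have := ge_min y' x' (minn y (mirror m n x)) le_x'.
rewrite (perm_mem eq_num) => /(_ (in_min _ _ lt_yx le_x)).
have := ge_min y x (minn y' (mirror m n x')) le_x.
rewrite -(perm_mem eq_num) => /(_ (in_min _ _ lt_yx' le_x')).
by lia.
Qed.

(** Whether the hook with the same numbers exists after the jump from x to y: only
the mirrored jump is possible, because x itself has become vacant. *)
Definition second_jump m n I x y : bool :=
  swap I x y (mirror m n y) && ~~ swap I x y (mirror m n x).

Definition mhrg_result m n I x y : pred nat :=
  if second_jump m n I x y then
    swap (swap I x y) (mirror m n y) (mirror m n x)
  else swap I x y.

Lemma second_jumpP m n I x y : jump m n I x y -> second_jump m n I x y ->
  jump m n (swap I x y) (mirror m n y) (mirror m n x).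
Proof.
by case=> ? ? ? ? /andP[? ?]; split => //; lia.
Qed.

Lemma mhrg_moveP m n I Z : above m n I 1 = m ->
  mhrg_move m n (diagram_of m n I) Z <->
  exists x y, jump m n I x y /\ Z = diagram_of m n (mhrg_result m n I x y).
Proof.
move=> cardI.
have sameE b x y b' x' y' : jump m n I x y -> rim_ends m n I b x y ->
    jump m n (swap I x y) x' y' -> rim_ends m n (swap I x y) b' x' y' ->
    same_hook_numbers m n (diagram_of m n I) b
      (diagram_of m n (swap I x y)) b' =
    (x' == mirror m n y) && (y' == mirror m n x).
  move=> xyP bP xyP' bP'; have card' := above_swap1 m n I x y cardI xyP.
  rewrite /same_hook_numbers
    (permPl (hook_numbers_diagram _ _ _ _ _ _ card' xyP' bP')).
  rewrite (permPr (hook_numbers_diagram _ _ _ _ _ _ cardI xyP bP)).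
  case: (xyP) (xyP') => Ix Iy lt_yx le_x [Ix' Iy' lt_yx' le_x'].
  rewrite perm_rim_numbers //.
  case: (eqVneq x' x) => [eq_x|] ; last by lia.
  by move: Ix'; rewrite /swap eq_x eqxx; lia.
split=> [[b Yb]|[x [y [xyP ->]]]].
  have [x [y [xyP bP]]] := jump_of_box _ _ _ _ cardI Yb.
  have card' := above_swap1 m n I x y cardI xyP.
  rewrite /= (remove_hook_diagram _ _ _ _ _ _ cardI xyP bP).
  case=> [[no_same ->]|[b' [Yb' same ->]]]; exists x, y; split=> //.
    rewrite /mhrg_result; case: ifP => // twice.
    have xyP' := second_jumpP _ _ _ _ _ xyP twice.
    have [b' Yb' bP'] := box_of_jump _ _ _ _ _ card' xyP'.
    by have := no_same _ Yb'; rewrite (sameE _ _ _ _ _ _ xyP bP xyP' bP') !eqxx.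
  have [x' [y' [xyP' bP']]] := jump_of_box _ _ _ _ card' Yb'.
  rewrite (remove_hook_diagram _ _ _ _ _ _ card' xyP' bP').
  move: same; rewrite (sameE _ _ _ _ _ _ xyP bP xyP' bP').
  case/andP=> /eqP eq_x /eqP eq_y; case: (xyP') => Ix' Iy' _ _.
  by rewrite /mhrg_result /second_jump -eq_x -eq_y Ix' Iy'.
have [b Yb bP] := box_of_jump _ _ _ _ _ cardI xyP.
have card' := above_swap1 m n I x y cardI xyP.
exists b => //=; rewrite (remove_hook_diagram _ _ _ _ _ _ cardI xyP bP).
rewrite /mhrg_result; case: ifPn => twice; [right|left].
  have xyP' := second_jumpP _ _ _ _ _ xyP twice.
  have [b' Yb' bP'] := box_of_jump _ _ _ _ _ card' xyP'.
  exists b'; rewrite (sameE _ _ _ _ _ _ xyP bP xyP' bP') !eqxx.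
  by rewrite (remove_hook_diagram _ _ _ _ _ _ card' xyP' bP').
split=> // b' Yb'.
have [x' [y' [xyP' bP']]] := jump_of_box _ _ _ _ card' Yb'.
rewrite (sameE _ _ _ _ _ _ xyP bP xyP' bP').
apply: contra twice => /andP[/eqP eq_x /eqP eq_y].
by case: (xyP') => Ix' Iy' _ _; rewrite /second_jump -eq_x -eq_y Ix' Iy'.
Qed.

Lemma mhrg_result_above1 m n I x y : above m n I 1 = m -> jump m n I x y ->
  above m n (mhrg_result m n I x y) 1 = m.
Proof.
move=> cardI xyP; have card' := above_swap1 m n I x y cardI xyP.
rewrite /mhrg_result; case: ifP => // twice.
exact: above_swap1 card' (second_jumpP _ _ _ _ _ xyP twice).
Qed.

(** With z equal to its own mirror image, the condition also excludes a bead in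
the centre of [1, m + n] when m + n is odd. *)
Definition asymmetric (m n : nat) (I : pred nat) : Prop :=
  forall z, 0 < z <= m + n -> I z -> ~~ I (mirror m n z).

(** The jump from x to y can only break asymmetry by the pair y, mirror y. In that
case mirror y is a bead and mirror x is vacant, as x was a bead, so that the
second jump repairs it by taking mirror y to mirror x. *)
Lemma mhrg_result_asymmetric m n I x y :
  asymmetric m n I -> jump m n I x y -> asymmetric m n (mhrg_result m n I x y).
Proof.
move=> asymI [Ix Iy lt_yx le_x].
have Irx := asymI x ltac:(lia) Ix.
have ne_rx : mirror m n x != x by apply: contraNneq Irx => ->.
rewrite /mhrg_result /second_jump /swap; case: ifPn => [_|single] z zP.
  have := asymI z zP.
  have [->|ne1] := eqVneq z (mirror m n x).
    by rewrite (_ : mirror m n (mirror m n x) = x); lia.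
  have [->|ne2] := eqVneq z y; first by lia.
  by lia.
have := asymI z zP; move: single; rewrite (negPf Irx) /= orbF.
have [->|ne1] := eqVneq z y; first by lia.
have [->|ne2] := eqVneq z (mirror m n y).
  by rewrite (_ : mirror m n (mirror m n y) = y); lia.
by lia.
Qed.

(** * Reachable positions are the asymmetric ones *)

Lemma diagram_of_full m n I : above m n I 1 = m -> above m n I n.+1 = m ->
  diagram_of m n I = rectangle m n.
Proof.
move=> cardI fullI; apply/fsetP => -[a b].
rewrite mem_diagram_of // mem_rectangle /=; set t := b + m.+1 - a.
have out := above_out m n I (m + n).+1 (leqnn _).
have := above_bounds m n I 1 t; have := above_bounds m n I t n.+1.
have := above_bounds m n I n.+1 t; have := above_bounds m n I t (m + n).+1.
have [far|near] := ltnP (m + n) t; first by have := above_out m n I t far; lia.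
have [t_gt0|] := ltnP 0 t; first by lia.
move=> t0; have e0 : t = 0 by lia.
by rewrite e0 (aboveS m n I 0) // cardI; case: (I 0); lia.
Qed.

Lemma above_gtn m n : above m n (ltn n) 1 = m /\ above m n (ltn n) n.+1 = m.
Proof.
have fullI : above m n (ltn n) n.+1 = m.
  rewrite /above (_ : count _ _ = count predT (iota n.+1 ((m + n).+1 - n.+1))).
    by rewrite count_predT size_iota; lia.
  by apply: eq_in_count => z; rewrite mem_iota /=; lia.
split=> //; have := above_bounds m n (ltn n) 1 n.+1 isT.
have [|/(above_lt_exists m n (ltn n) 1 n.+1 isT)[w wP /=]] :=
  leqP (above m n (ltn n) 1) (above m n (ltn n) n.+1); lia.
Qed.

Lemma reachable_asymmetric m n Y : m <= n -> reachable m n Y ->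
  exists I, [/\ above m n I 1 = m, asymmetric m n I & Y = diagram_of m n I].
Proof.
move=> le_mn; elim=> [|{}Y Z _ [I [cardI asymI ->]]].
  have [cardI fullI] := above_gtn m n.
  exists (ltn n); rewrite diagram_of_full //; split=> // z _ /=; lia.
case/(mhrg_moveP _ _ _ _ cardI) => x [y [xyP ->]].
exists (mhrg_result m n I x y); split=> //.
  exact: mhrg_result_above1.
exact: mhrg_result_asymmetric.
Qed.

Lemma eq_diagram_of m n I J : {in [pred t | 0 < t <= m + n], I =1 J} ->
  above m n I 1 = m -> diagram_of m n I = diagram_of m n J.
Proof.
move=> eqIJ cardI; have eqA := eq_above _ _ _ _ eqIJ.
have cardJ : above m n J 1 = m by rewrite -eqA.
apply/fsetP => -[a b]; rewrite !mem_diagram_of //=.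
have [t_gt0|] := ltnP 0 (b + m.+1 - a); first by rewrite eqA.
move=> t0; have e0 : b + m.+1 - a = 0 by lia.
by rewrite e0 !(aboveS m n _ 0) // cardI cardJ; case: (I 0); case: (J 0); lia.
Qed.

(** Raising the bead w to z gives a position from which lowering z back to w is a
single jump: the second one would need a bead at the mirror of w, which
asymmetry excludes. The last hypothesis is what asymmetry needs at z. *)
Lemma asymmetric_predecessor m n I w z :
    above m n I 1 = m -> asymmetric m n I -> I w -> ~~ I z ->
    0 < w < z -> z <= m + n -> mirror m n z != z ->
    ~~ I (mirror m n z) || (mirror m n z == w) ->
  [/\ above m n (swap I w z) 1 = m, asymmetric m n (swap I w z),
      mhrg_move m n (diagram_of m n (swap I w z)) (diagram_of m n I)
    & forall t, 0 < t ->
        above m n (swap I w z) t = above m n I t + (w < t <= z)].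
Proof.
move=> cardI asymI Iw Iz lt_wz le_z ne_rz rzP.
have zwP : jump m n (swap I w z) z w by split=> //; rewrite /swap ?eqxx; lia.
have swapK u : swap (swap I w z) z w u = I u.
  rewrite /swap; have [->|_] := eqVneq u w; first by rewrite Iw.
  by have [->|_] := eqVneq u z; [rewrite (negPf Iz) | rewrite !andbT].
have aboveE t : 0 < t ->
    above m n (swap I w z) t = above m n I t + (w < t <= z).
  move=> t_gt0; rewrite (above_swap _ _ _ _ _ t zwP); congr (_ + _).
  by apply: eq_above t_gt0 => u _; apply: swapK.
have card' : above m n (swap I w z) 1 = m by rewrite aboveE // cardI; lia.
have Irw := asymI w ltac:(lia) Iw.
split=> // [u uP|].
  rewrite /swap; have := asymI u uP.
  have [->|ne1] := eqVneq u z; first by lia.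
  have [eq_u|ne2] := eqVneq (mirror m n u) z; last by lia.
  have -> : u = mirror m n z by lia.
  by lia.
apply/(mhrg_moveP _ _ _ _ card'); exists z, w; split=> //.
rewrite /mhrg_result /second_jump !swapK (negPf Irw) /=.
by apply: eq_diagram_of => // u _; rewrite swapK.
Qed.

(** Induction on the number of beads in the left half plus the number of beads
that are at most n; every step to a predecessor lowers one of the two without
raising the other. *)
Lemma asymmetric_reachable m n I : m <= n ->
  above m n I 1 = m -> asymmetric m n I -> reachable m n (diagram_of m n I).
Proof.
move=> le_mn; pose h := (m + n)./2.+1.
have [k le_k] := ubnP ((m - above m n I h) + (m - above m n I n.+1)).
elim: k => // k IHk in I le_k *; move=> cardI asymI.
have bndn := above_bounds m n I 1 n.+1 isT.
have step w z : I w -> ~~ I z -> 0 < w < z -> z <= m + n -> mirror m n z != z ->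
    ~~ I (mirror m n z) || (mirror m n z == w) -> w < h <= z \/ w < n.+1 <= z ->
    reachable m n (diagram_of m n I).
  move=> Iw Iz lt_wz le_z ne_rz rzP cross.
  have [card' asym' mv aboveE] := asymmetric_predecessor _ _ _ _ _ cardI asymI
    Iw Iz lt_wz le_z ne_rz rzP.
  apply: reachable_move mv; apply: IHk => //.
  have := above_bounds m n (swap I w z) 1 h isT.
  have := above_bounds m n (swap I w z) 1 n.+1 isT.
  rewrite card' !aboveE; lia.
(* A bead in the left half is raised to its mirror image. *)
have [left_empty|] := leqP m (above m n I h); last first.
  move=> lt_h; have [w wP Iw] : exists2 w, 1 <= w < h & I w.
    by apply: (above_lt_exists m n); rewrite ?cardI.
  have Irw := asymI w ltac:(lia) Iw.
  apply: (step w (mirror m n w)) => //; rewrite /h in wP *; lia.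
have ge_h u : 0 < u -> I u -> h <= u.
  move=> u_gt0 Iu; rewrite leqNgt; apply/negP => lt_uh.
  have := above_bounds m n I 1 u u_gt0.
  have := above_bounds m n I u.+1 h lt_uh.
  by have := aboveS m n I u ltac:(lia); rewrite Iu; lia.
have [full|] := leqP m (above m n I n.+1).
  by rewrite diagram_of_full; [left | lia..].
move=> lt_n; have [w wP Iw] : exists2 w, 1 <= w < n.+1 & I w.
  by apply: (above_lt_exists m n); rewrite ?cardI.
(* With all beads in the right half, the mirror of z > n is vacant. *)
have /allPn[z] : ~~ all I (iota n.+1 m).
  by rewrite all_count size_iota; move: lt_n; rewrite /above subSS addnK; lia.
rewrite mem_iota => zP Iz; have := ge_h w; have := ge_h (mirror m n z).
by rewrite /h => Irz w_ge_h; apply: (step w z) => //; lia.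
Qed.

(** * Partitions and their beads *)

(** If I has more beads than J at or beyond t, the box of row
above m n J t + 1 that tests the position t lies in the diagram of I only. Its
column index is positive because J has at most t - 1 beads below t. *)
Lemma diagram_of_inj m n I J :
    above m n I 1 = m -> above m n J 1 = m ->
  diagram_of m n I = diagram_of m n J -> {in [pred t | 0 < t <= m + n], I =1 J}.
Proof.
move=> cardI cardJ eqIJ.
have le_above A B t : above m n A 1 = m -> above m n B 1 = m ->
    diagram_of m n A = diagram_of m n B -> 0 < t ->
    above m n A t <= above m n B t.
  move=> cardA cardB eqAB t_gt0; rewrite leqNgt; apply/negP => lt_BA.
  have bndB := above_bounds m n B 1 t t_gt0.
  have bndA := above_bounds m n A 1 t t_gt0.
  have := mem_diagram_of m n A
    ((above m n B t).+1, t + (above m n B t).+1 - m.+1) cardA.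
  rewrite eqAB mem_diagram_of //=.
  have -> : t + (above m n B t).+1 - m.+1 + m.+1 - (above m n B t).+1 = t by lia.
  by lia.
have eq_A t : 0 < t -> above m n I t = above m n J t.
  by move=> t_gt0; apply/eqP; rewrite eqn_leq !le_above.
move=> t; rewrite inE => tP; have := eq_A t.+1 isT; have := eq_A t ltac:(lia).
by rewrite !(aboveS m n _ t); try lia; case: (I t); case: (J t) => //; lia.
Qed.

Lemma part_bounds m n (lam : m.-tuple nat) i i' : boxed_partition n lam ->
  0 < i <= i' -> i' <= m -> part lam i' <= part lam i <= n.
Proof.
rewrite /boxed_partition => lamP le_ii' le_i'.
have geq_trans : transitive geq by move=> ? ? ? /= ? ?; lia.
rewrite /part; apply/andP; split.
  apply: (sorted_leq_nth geq_trans leqnn 0 (path_sorted lamP));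
    by rewrite ?inE ?size_tuple; lia.
have /allP := order_path_min geq_trans lamP; apply.
by rewrite mem_nth ?size_tuple; lia.
Qed.

Lemma part_le m n (lam : m.-tuple nat) i : boxed_partition n lam ->
  0 < i <= m -> part lam i <= n.
Proof.
by move=> lamP iP; have /andP[] := part_bounds m n lam i i lamP ltac:(lia)
  ltac:(lia).
Qed.

Lemma mem_I_set m (lam : m.-tuple nat) z :
  reflect (exists2 i, 0 < i <= m & z = part lam i + m.+1 - i) (z \in I_set lam).
Proof.
apply: (iffP (imfsetP _ _ _ _)) => [[t /=]|[i iP ->]].
  by rewrite mem_iota => tP ->; exists (m - t + 1); lia.
exists (m.+1 - i); rewrite /= ?mem_iota; first by lia.
by rewrite (_ : m - (m.+1 - i) + 1 = i); lia.
Qed.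

Definition beads {m : nat} (lam : m.-tuple nat) : pred nat :=
  fun z => z \in I_set lam.

Lemma above_I_set_le m n (lam : m.-tuple nat) i t :
  (forall i', i < i' <= m -> part lam i' + m.+1 - i' < t) ->
  above m n (beads lam) t <= i.
Proof.
move=> small; rewrite /above -size_filter.
have -> : i = size [seq part lam k + m.+1 - k | k <- iota 1 i].
  by rewrite size_map size_iota.
apply: uniq_leq_size.
  exact/filter_uniq/iota_uniq.
move=> z; rewrite mem_filter mem_iota => /andP[/mem_I_set[i' i'P ->]] le_t.
apply: map_f; rewrite mem_iota; have := small i'; lia.
Qed.

(** The beads strictly decrease with the row, so that of row i is the i-th
largest. *)
Lemma above_I_set m n (lam : m.-tuple nat) i : boxed_partition n lam ->
  0 < i <= m -> above m n (beads lam) (part lam i + m.+1 - i) = i.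
Proof.
move=> lamP iP; apply/eqP; rewrite eqn_leq; apply/andP; split.
  apply: above_I_set_le => i' lt_ii'.
  by have := part_bounds m n lam i i' lamP; lia.
elim: i iP => // i IHi iP.
have := part_bounds m n lam i.+1 i.+1 lamP.
set x := _ + _ - _ => bnd; rewrite aboveS; last by rewrite /x; lia.
have -> : beads lam x by apply/mem_I_set; exists i.+1.
case: i => [|i] in IHi iP bnd x *; first by lia.
have := part_bounds m n lam i.+1 i.+2 lamP.
have := above_bounds m n (beads lam) x.+1 (part lam i.+1 + m.+1 - i.+1).
rewrite /x; lia.
Qed.

Lemma above_I_set1 m n (lam : m.-tuple nat) : 0 < m -> boxed_partition n lam ->
  above m n (beads lam) 1 = m.
Proof.
move=> m_gt0 lamP; apply/eqP; rewrite eqn_leq above_I_set_le /=; last by lia.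
have := above_I_set m n lam m lamP; rewrite m_gt0 leqnn => /(_ isT) {1}<-.
by have /andP[] := above_bounds m n (beads lam) 1 (part lam m + m.+1 - m)
  ltac:(lia).
Qed.

Lemma young_diagram_of m n (lam : m.-tuple nat) : 0 < m ->
  boxed_partition n lam -> young lam = diagram_of m n (beads lam).
Proof.
move=> m_gt0 lamP; have card1 := above_I_set1 m n lam m_gt0 lamP.
apply/fsetP => -[a b]; rewrite mem_diagram_of //=; set t := b + m.+1 - a.
have -> : ((a, b) \in young lam) = (0 < a <= m) && (0 < b <= part lam a).
  apply/imfset2P/idP => [[i + [j + [-> ->]]]|abP] /=.
    by rewrite !mem_iota; lia.
  by exists a; [rewrite mem_iota; lia | exists b => //; rewrite mem_iota; lia].
have [aP|aNP] := boolP (0 < a <= m).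
  have eq_a := above_I_set m n lam a lamP aP.
  have Ix : beads lam (part lam a + m.+1 - a) by apply/mem_I_set; exists a.
  have le_n := part_le m n lam a lamP aP.
  move: (part lam a) le_n eq_a Ix => p le_n; set x := p + _ - _ => eq_a Ix.
  have := aboveS m n (beads lam) x; rewrite Ix eq_a.
  have := above_bounds m n (beads lam) t x.
  have := above_bounds m n (beads lam) x.+1 t.
  by lia.
have := above_bounds m n (beads lam) 1 t.
have := above_bounds m n (beads lam) 0 1 isT.
by have [t0|] := posnP t; [rewrite t0|]; lia.
Qed.

Lemma mhrg_position_asymmetric m n (lam : m.-tuple nat) : 0 < m -> m <= n ->
  boxed_partition n lam ->
  mhrg_position m n (young lam) <-> asymmetric m n (beads lam).
Proof.
move=> m_gt0 le_mn lamP; have card1 := above_I_set1 m n lam m_gt0 lamP.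
have defY := young_diagram_of m n lam m_gt0 lamP.
split=> [[_ reachY]|asymI].
  have [I [cardI asymI eqY]] := reachable_asymmetric m n _ le_mn reachY.
  rewrite defY in eqY; have eqI := diagram_of_inj _ _ _ _ card1 cardI eqY.
  move=> z zP; rewrite !eqI ?inE; try lia.
  exact: asymI.
split; first by exists lam.
by rewrite defY; apply: asymmetric_reachable.
Qed.

Lemma part_dual m n (lam : m.-tuple nat) i : 0 < i <= m ->
  part (dual n lam) i = n - part lam (m.+1 - i).
Proof.
move=> iP; rewrite /part /= nth_rev size_map size_tuple; last by lia.
by rewrite (nth_map 0) ?size_tuple; [congr (_ - nth _ _ _)|]; lia.
Qed.

Lemma dual_boxed m n (lam : m.-tuple nat) :
  boxed_partition n lam -> boxed_partition n (dual n lam).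
Proof.
move=> lamP; apply/(pathP 0) => i; rewrite size_tuple => lt_im.
have -> : nth 0 (dual n lam) i = part (dual n lam) i.+1 by [].
rewrite part_dual /=; last by lia.
case: i lt_im => [|i] lt_im /=; first by lia.
have -> : nth 0 (dual n lam) i = part (dual n lam) i.+1 by [].
rewrite part_dual; last by lia.
by have := part_bounds m n lam (m.+1 - i.+2) (m.+1 - i.+1) lamP; lia.
Qed.

Lemma mem_I_set_dual m n (lam : m.-tuple nat) z : boxed_partition n lam ->
  0 < z <= m + n -> (z \in I_set (dual n lam)) = (mirror m n z \in I_set lam).
Proof.
move=> lamP zP; apply/mem_I_set/mem_I_set => -[i iP def_z].
  have rowP : 0 < m.+1 - i <= m by lia.
  have := part_le m n lam _ lamP rowP; rewrite part_dual // in def_z.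
  by exists (m.+1 - i) => //; lia.
have rowP : 0 < m.+1 - i <= m by lia.
have := part_le m n lam _ lamP iP; exists (m.+1 - i) => //.
by rewrite part_dual // subKn; lia.
Qed.

Lemma asymmetric_dual m n (lam : m.-tuple nat) : boxed_partition n lam ->
  asymmetric m n (beads lam) -> asymmetric m n (beads (dual n lam)).
Proof.
move=> lamP asymI z zP; rewrite /beads !mem_I_set_dual //; last by lia.
by move=> Irz; apply: asymI Irz; lia.
Qed.

(** By [mem_I_set_dual], I_R(Y) and I_R(Y^D) meet where a bead of the right half
has a mirror bead. One of the two members of a mirrored pair is always in the
range defining I_R; when m + n is even that range also contains the left
neighbour of the centre, which only repeats the pair of central positions. *)
Lemma asymmetric_I_R m n (lam : m.-tuple nat) : 0 < m ->
  boxed_partition n lam ->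
  asymmetric m n (beads lam) <->
  I_R n lam `&` I_R n (dual n lam) = fset0.
Proof.
move=> m_gt0 lamP; split=> [asymI|disj].
  apply/fsetP => z; rewrite in_fsetI !in_fset !inE; apply/negP.
  have [zP|] := boolP (0 < z <= m + n); last first.
    by rewrite /cmid /chi; case: ifP; lia.
  case/andP=> /andP[Iz _] /andP[Idz _]; have /negP[] := asymI z zP Iz.
  by rewrite /beads -(mem_I_set_dual _ _ _ _ lamP zP).
have noI u : 0 < u <= m + n -> cmid m n + 1 - chi m n <= u ->
    u \in I_set lam -> mirror m n u \notin I_set lam.
  move=> uP u_right Iu; rewrite -(mem_I_set_dual _ _ _ _ lamP uP).
  apply/negP => Idu; have /negP[] := in_fset0 u; rewrite -disj in_fsetI.
  rewrite !in_fset !inE u_right; have /andP[_ ->] := uP.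
  by rewrite !andbT; apply/andP.
move=> z zP Iz; have [z_right|rz_right] : cmid m n + 1 - chi m n <= z \/
    cmid m n + 1 - chi m n <= mirror m n z.
- by rewrite /cmid /chi; case: ifP; lia.
- exact: noI.
apply/negP => Irz; have /negP[] := noI (mirror m n z) ltac:(lia) rz_right Irz.
by rewrite subKn //; lia.
Qed.

Lemma asymmetric_parts m n (lam : m.-tuple nat) : m <= n ->
  boxed_partition n lam ->
  asymmetric m n (beads lam) <->
  (forall i j : nat, 1 <= i -> i <= j -> j <= m ->
     part lam i + part lam j <> n - m + i + j - 1).
Proof.
move=> le_mn lamP; split=> [asymI i j i_gt0 le_ij le_jm eq_ij|no_ij].
  have le_in := part_le m n lam i lamP ltac:(lia).
  have le_jn := part_le m n lam j lamP ltac:(lia).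
  have iP : 0 < i <= m by lia.
  have jP : 0 < j <= m by lia.
  have zP : 0 < part lam i + m.+1 - i <= m + n by lia.
  have /negP[] : ~~ beads lam (mirror m n (part lam i + m.+1 - i)).
    by apply: asymI zP _; apply/mem_I_set; exists i.
  by apply/mem_I_set; exists j => //; lia.
move=> z zP /mem_I_set[i iP def_z]; apply/negP => /mem_I_set[j jP def_rz].
have le_in := part_le m n lam i lamP iP.
have le_jn := part_le m n lam j lamP jP.
by have := no_ij i j; have := no_ij j i; lia.
Qed.

Theorem theorem1p1 (m n : nat) (m_gt0 : 0 < m) (le_mn : m <= n)
    (Y : diagram) (lam : m.-tuple nat)
    (lamP : boxed_partition n lam) (defY : Y = young lam) :
  [<-> mhrg_position m n Y;
       mhrg_position m n (young (dual n lam));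
       I_R n lam `&` I_R n (dual n lam) = fset0;
       forall i j : nat, 1 <= i -> i <= j -> j <= m ->
         part lam i + part lam j <> n - m + i + j - 1 ].
Proof.
have dualP := dual_boxed m n lam lamP.
have posP := mhrg_position_asymmetric m n _ m_gt0 le_mn.
tfae.
- rewrite defY => /(posP _ lamP) asymI; apply/(posP _ dualP).
  exact: asymmetric_dual.
- move=> /(posP _ dualP) asymD; apply/(asymmetric_I_R _ _ _ m_gt0 lamP).
  move=> z zP /= Iz; have := asymD (mirror m n z) ltac:(lia).
  rewrite /beads !mem_I_set_dual //; try lia.
  by rewrite (_ : mirror m n (mirror m n z) = z) //; [apply|lia].
- move=> /(asymmetric_I_R _ _ _ m_gt0 lamP).
  by move/(asymmetric_parts _ _ _ le_mn lamP).
- by rewrite defY => /(asymmetric_parts _ _ _ le_mn lamP) /(posP _ lamP).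
Qed.
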